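(* Let $\Gamma=A*_\phi$ with $\phi:C_{-1}\to C_{+1}$ be an HNN extension, and let $x,y\in\Gamma$ be two elements which commute. Then: (i) If $x\in C_{+1}\cup C_{-1}$ and $y$ is written in reduced form $y=y_1t^{\varepsilon_1}y_2\cdots y_nt^{\varepsilon_n}y_{n+1}$, then there is a sequence $(c_0,c_1,\dots,c_{2n+1})$ of elements of $C_{+1}\cup C_{-1}$ with $c_0=c_{2n+1}=x$ such that, for $0\le i\le 2n$, $c_i$ and $c_{i+1}$ are conjugate by $y_{\frac i2+1}$ if $i$ is even (i.e. $c_i=y_{\frac i2+1}\,c_{i+1}\,y_{\frac i2+1}^{-1}$), and by $t^{\varepsilon_j}$ with $j=\frac{i-1}2+1$ if $i$ is odd (i.e. $c_i=t^{\varepsilon_j}c_{i+1}t^{-\varepsilon_j}$). (ii) If $x$ is in a conjugate $gAg^{-1}$ of $A$ and is not conjugate to an element of $C_{+1}\cup C_{-1}$, then $y$ is in the same conjugate $gAg^{-1}$. (iii) If neither $x$ nor $y$ is in a conjugate of $A$, then $x=gcg^{-1}W^j$ and $y=gc'g^{-1}W^k$ for some $g,W\in\Gamma$, $j,k\in\mathbb{Z}$, and $c,c'\in C_{+1}$ (respectively $c,c'\in C_{-1}$), such that $gcg^{-1}$, $gc'g^{-1}$ and $W$ commute pairwise. Moreover at least one of the following cases occurs: (i') $x$ or $y$ is conjugate to an element of $C_{+1}\cup C_{-1}$; or the hypothesis (hence the conclusion) of (ii) holds; or the hypothesis (hence the conclusion) of (iii) holds.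
   Context: Let $A$ be a group, $C_{-1},C_{+1}$ subgroups of $A$ and $\phi:C_{-1}\to C_{+1}$ an isomorphism. The HNN extension is $A*_\phi=\langle A,t\mid t^{-1}ct=\phi(c)\ \forall c\in C_{-1}\rangle$, and $A$ is identified with its (injective) image. A reduced form of $y\in A*_\phi$ is an expression $y=y_1t^{\varepsilon_1}y_2\cdots t^{\varepsilon_n}y_{n+1}$, $n\ge0$, with $y_i\in A$, $\varepsilon_i=\pm1$, containing no subword $t^{\varepsilon}ct^{-\varepsilon}$ with $c\in C_\varepsilon$. The parenthetical ''respectively'' in (iii) means: either both $c,c'$ lie in $C_{+1}$, or both lie in $C_{-1}$. *)

(* Defs.v *)
From HB Require Import structures.
From mathcomp Require Import all_boot ssralg ssrint boolp.

Set Implicit Arguments.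
Unset Strict Implicit.
Unset Printing Implicit Defensive.

Local Open Scope group_scope.
Local Open Scope quotient_scope.

Definition expgz (G : groupType) (x : G) (k : int) : G :=
  match k with Posz n => x ^+ n | Negz n => x ^- n.+1 end.

(* [true] stands for the sign +1 and [false] for -1. *)
Definition assoc_pred (A : groupType) (Cm Cp : {pred A}) (e : bool) : {pred A} :=
  if e then Cp else Cm.

(* The HNN extension is built as the group presented by the generators        *)
(* A + {t, t^-1}: words in [seq (A + bool)], where [inl a] is the letter a    *)
(* and [inr e] is the letter t^e, modulo the least congruence for             *)
(* concatenation that contains the multiplication table of A, the             *)
(* cancellations t^e t^-e = 1 and the relations t^-1 c t = phi c, c in Cm.    *)
(* The types Sm, Sp carry the group structures induced on the subgroups Cm,   *)
(* Cp of A, with [val] the inclusion into A.                                  *)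
Section HNN.

Variables (A : groupType) (Cm Cp : {pred A}).
Variables (Sm : subGroupType Cm) (Sp : subGroupType Cp).
Variable phi : {multiplicative Sm -> Sp}.

Local Notation hnn_word := (seq (A + bool)).

Inductive hnn_eq : hnn_word -> hnn_word -> Prop :=
| HnnRefl u : hnn_eq u u
| HnnSym u v : hnn_eq u v -> hnn_eq v u
| HnnTrans u v w : hnn_eq u v -> hnn_eq v w -> hnn_eq u w
| HnnCat u u' v v' : hnn_eq u u' -> hnn_eq v v' -> hnn_eq (u ++ v) (u' ++ v')
| HnnOne : hnn_eq [:: inl 1] [::]
| HnnMul a b : hnn_eq [:: inl a; inl b] [:: inl (a * b)]
| HnnCancel e : hnn_eq [:: inr e; inr (~~ e)] [::]
| HnnConj (c : Sm) :
    hnn_eq [:: inr false; inl (val c); inr true] [:: inl (val (phi c))].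

Definition hnn_rel : rel hnn_word := fun u v => `[< hnn_eq u v >].

Lemma hnn_rel_refl : reflexive hnn_rel.
Proof. by move=> u; apply/asboolP; exact: HnnRefl. Qed.

Lemma hnn_rel_sym : symmetric hnn_rel.
Proof. by move=> u v; apply/asboolP/asboolP; exact: HnnSym. Qed.

Lemma hnn_rel_trans : transitive hnn_rel.
Proof.
move=> v u w /asboolP uv /asboolP vw; apply/asboolP; exact: HnnTrans uv vw.
Qed.

Canonical hnn_equiv := EquivRel hnn_rel hnn_rel_refl hnn_rel_sym hnn_rel_trans.

Definition hnn : Type := {eq_quot hnn_equiv}.

HB.instance Definition _ := Choice.on hnn.
HB.instance Definition _ := EqQuotient.on hnn.

Lemma hnn_piP (u v : hnn_word) : \pi_hnn u = \pi_hnn v <-> hnn_eq u v.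
Proof.
split=> [uv|uv]; last by apply/eqmodP/asboolP.
by apply/asboolP; rewrite -[asbool _]/(hnn_equiv u v); apply/eqmodP.
Qed.

Lemma hnn_reprP (u : hnn_word) : hnn_eq (repr (\pi_hnn u)) u.
Proof. by apply/hnn_piP; rewrite reprK. Qed.

Definition hnn_letter_inv (l : A + bool) : A + bool :=
  match l with inl a => inl a^-1 | inr e => inr (~~ e) end.

Definition hnn_word_inv (u : hnn_word) : hnn_word := rev (map hnn_letter_inv u).

Lemma hnn_letter_invK : involutive hnn_letter_inv.
Proof. by case=> [a|e] /=; rewrite ?invgK ?negbK. Qed.

Lemma hnn_word_invK : involutive hnn_word_inv.
Proof.
by move=> u; rewrite /hnn_word_inv map_rev revK (mapK hnn_letter_invK).
Qed.

Lemma hnn_word_mulV u : hnn_eq (u ++ hnn_word_inv u) [::].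
Proof.
elim: u => [|l u IHu]; first exact: HnnRefl.
have -> : (l :: u) ++ hnn_word_inv (l :: u) =
    [:: l] ++ (u ++ hnn_word_inv u) ++ [:: hnn_letter_inv l].
  by rewrite /hnn_word_inv /= rev_cons -cats1 -!catA.
apply: (@HnnTrans _ ([:: l] ++ [:: hnn_letter_inv l])).
  exact: HnnCat (HnnRefl _) (HnnCat IHu (HnnRefl _)).
case: l => [a|e] /=; last exact: HnnCancel.
by apply: HnnTrans (HnnMul _ _) _; rewrite mulgV; exact: HnnOne.
Qed.

Lemma hnn_word_Vmul u : hnn_eq (hnn_word_inv u ++ u) [::].
Proof. by have := hnn_word_mulV (hnn_word_inv u); rewrite hnn_word_invK. Qed.

Definition hnn_mul (x y : hnn) : hnn := \pi_hnn (repr x ++ repr y).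
Definition hnn_one : hnn := \pi_hnn [::].
Definition hnn_inv (x : hnn) : hnn := \pi_hnn (hnn_word_inv (repr x)).

Lemma hnn_mul_pi u v : hnn_mul (\pi_hnn u) (\pi_hnn v) = \pi_hnn (u ++ v).
Proof. by apply/hnn_piP; apply: HnnCat; exact: hnn_reprP. Qed.

Lemma hnn_mulA : associative hnn_mul.
Proof.
elim/quotW=> u; elim/quotW=> v; elim/quotW=> w.
by rewrite (hnn_mul_pi v) (hnn_mul_pi u v) !hnn_mul_pi catA.
Qed.

Lemma hnn_mul1 : left_id hnn_one hnn_mul.
Proof. by elim/quotW=> u; rewrite hnn_mul_pi. Qed.

Lemma hnn_mulr1 : right_id hnn_one hnn_mul.
Proof. by elim/quotW=> u; rewrite hnn_mul_pi cats0. Qed.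

Lemma hnn_mulV : left_inverse hnn_one hnn_inv hnn_mul.
Proof.
move=> x; rewrite -{2}[x]reprK /hnn_inv hnn_mul_pi.
by apply/hnn_piP; exact: hnn_word_Vmul.
Qed.

Lemma hnn_mulrV : right_inverse hnn_one hnn_inv hnn_mul.
Proof.
move=> x; rewrite -{1}[x]reprK /hnn_inv hnn_mul_pi.
by apply/hnn_piP; exact: hnn_word_mulV.
Qed.

HB.instance Definition _ :=
  isGroup.Build hnn hnn_mulA hnn_mul1 hnn_mulr1 hnn_mulV hnn_mulrV.

(* The canonical map A -> hnn, along which A is identified with its image. *)
Definition hnn_in (a : A) : hnn := \pi_hnn [:: inl a].

Definition hnn_t : hnn := \pi_hnn [:: inr true].

Definition hnn_texp (e : bool) : hnn := if e then hnn_t else hnn_t^-1.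

Lemma hnn_in_morph : {morph hnn_in : a b / a * b}.
Proof.
move=> a b; rewrite -[RHS]/(hnn_mul _ _) hnn_mul_pi.
by apply/hnn_piP/HnnSym; exact: HnnMul.
Qed.

HB.instance Definition _ := isMultiplicative.Build A hnn hnn_in hnn_in_morph.

Lemma hnn_texpE e : hnn_texp e = \pi_hnn [:: inr e].
Proof.
case: e => //; rewrite /hnn_texp; apply: (mulgI hnn_t); rewrite mulgV.
rewrite -[RHS]/(hnn_mul _ _) hnn_mul_pi; apply/hnn_piP/HnnSym.
exact: HnnCancel true.
Qed.

Lemma hnn_conj (c : Sm) :
  hnn_t^-1 * hnn_in (val c) * hnn_t = hnn_in (val (phi c)).
Proof.
rewrite -[hnn_t^-1]/(hnn_texp false) hnn_texpE.
rewrite -[LHS]/(hnn_mul (hnn_mul _ _) _) (hnn_mul_pi [:: _]) hnn_mul_pi.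
by apply/hnn_piP; exact: HnnConj.
Qed.

Lemma hnn_universal (H : groupType) (f : {multiplicative A -> H}) (s : H) :
  (forall c : Sm, s^-1 * f (val c) * s = f (val (phi c))) ->
  exists! F : hnn -> H,
    [/\ {morph F : x y / x * y}, forall a, F (hnn_in a) = f a & F hnn_t = s].
Proof.
move=> fs; pose ev (l : A + bool) : H :=
  match l with inl a => f a | inr e => if e then s else s^-1 end.
pose E (u : hnn_word) : H := \prod_(l <- u) ev l.
have f1 : f 1 = 1 by apply: (mulgI (f 1)); rewrite -gmulfM !mulg1.
have Eeq u v : hnn_eq u v -> E u = E v.
  elim=> {u v} // [u v w _ -> _ -> //|u u' v v' _ Eu _ Ev||a b|e|c];
    rewrite /E ?big_cat ?big_cons ?big_nil ?mulg1 //=.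
  - by rewrite -[X in X * _]/(E u) -[X in _ * X]/(E v) Eu Ev.
  - by rewrite gmulfM.
  - by case: e; rewrite /= ?mulgV ?mulVg.
  - by rewrite mulgA fs.
have Epi u : E (repr (\pi_hnn u)) = E u by apply: Eeq; exact: hnn_reprP.
exists (fun x => E (repr x)); split.
  split=> [x y|a|].
  - by rewrite -[x * y]/(hnn_mul x y) Epi /E big_cat.
  - by rewrite Epi /E big_cons big_nil mulg1.
  - by rewrite Epi /E big_cons big_nil mulg1.
move=> F [FM Fin Ft]; apply/funext=> x; rewrite -{2}[x]reprK.
have F1 : F 1 = 1 by apply: (mulgI (F 1)); rewrite -FM !mulg1.
have FV : F hnn_t^-1 = s^-1.
  by apply: (mulgI s); rewrite -{1}Ft -FM !mulgV.
elim: (repr x) => [|l u IHu]; first by rewrite /E big_nil -F1.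
rewrite -cat1s -hnn_mul_pi FM -IHu /E big_cons -/(E u); congr (_ * _).
case: l => [a|e] /=; first by rewrite -[\pi_hnn _]/(hnn_in a) Fin.
by rewrite -hnn_texpE; case: e; rewrite /= ?Ft ?FV.
Qed.

Definition in_assoc (e : bool) (x : hnn) : Prop :=
  exists2 a, a \in assoc_pred Cm Cp e & x = hnn_in a.

Definition in_assocU (x : hnn) : Prop := in_assoc true x \/ in_assoc false x.

Definition in_conj_base (g x : hnn) : Prop := exists a, x = g * hnn_in a * g^-1.

Definition conj_to_assocU (x : hnn) : Prop :=
  exists g c : hnn, in_assocU c /\ x = g * c * g^-1.

(* The expression ys_1 t^eps_1 ys_2 ... t^eps_n ys_(n+1), with indices        *)
(* starting at 1; the values of ys and eps at other indices play no role.     *)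
Definition hnn_expr (n : nat) (ys : nat -> A) (eps : nat -> bool) : hnn :=
  (\prod_(1 <= i < n.+1) (hnn_in (ys i) * hnn_texp (eps i)))
    * hnn_in (ys n.+1).

Definition hnn_reduced (n : nat) (ys : nat -> A) (eps : nat -> bool) : Prop :=
  forall i, (1 <= i < n)%N -> eps i.+1 = ~~ eps i ->
    ys i.+1 \notin assoc_pred Cm Cp (eps i).

Definition reduced_form (y : hnn) (n : nat) (ys : nat -> A) (eps : nat -> bool)
  : Prop := hnn_reduced n ys eps /\ y = hnn_expr n ys eps.

Definition common_root_form (x y : hnn) : Prop :=
  exists (g W : hnn) (j k : int) (e : bool) (c c' : hnn),
    [/\ in_assoc e c /\ in_assoc e c',
        x = g * c * g^-1 * expgz W j,
        y = g * c' * g^-1 * expgz W k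
      & [/\ commute (g * c * g^-1) (g * c' * g^-1),
            commute (g * c * g^-1) W
          & commute (g * c' * g^-1) W]].

End HNN.

(* Main.v *)
Require Import Defs.
From HB Require Import structures.
From mathcomp Require Import all_boot ssralg ssrint boolp.
From mathcomp Require Import zify.

(** The proof rests on the action of the HNN extension on its Bass-Serre tree,
whose vertices are the cosets g A. The tree is never built: the geodesic from
the base vertex A to g A is recorded as the list [geod g] of pairs (coset
representative, sign of the stable letter) occurring in the normal form of g.
That normal forms are unique comes from letting the generators act on them
([act_hnn_eq]), in the manner of van der Waerden. Let lcp be the length of the
common prefix of two lists and |g| = [tlen g] the length of [geod g], that is
the distance from A to g A. Then [tlen_quo] states that
|g^-1 h| = |g| + |h| - 2 lcp (geod g) (geod h), and the tree is used only
through this formula and the ultrametric inequality for lcp.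

If a in A commutes with z not in A, then a z A = z A, so a fixes the first
edge of the geodesic from A to z A, and comparing first letters shows that the first
coset representative of z conjugates a into an associated subgroup. This
gives (ii) ([centralizer_base]); applied repeatedly along a reduced form, it
gives the chain of conjugations of (i) ([conj_chain]).

For (iii), Euclid's algorithm is run on the pair (x, y), which keeps the
subgroup generated by x and y. Suppose |x| <= |y|. For commuting elements the
four-point condition bounds |x y| + |x^-1 y| by 2 |y| ([commute_four_point]).
So either one of x y and x^-1 y is shorter than y and may replace it, or
|x y| = |x^-1 y| = |y|. In the latter case x A and x^-1 A have the same
midpoint on their geodesics from A, so that x fixes this midpoint
([elliptic_of_tlen]). The algorithm thus ends with a pair (c, W) where c is
conjugate into A, and x = c^i W^j, y = c^k W^l. If c were not conjugate into an
associated subgroup, (ii) would put W, hence x, in a conjugate of A. Finally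
the trichotomy follows by applying (ii) to (x, y) and to (y, x). *)

Set Implicit Arguments.
Unset Strict Implicit.
Unset Printing Implicit Defensive.

Local Open Scope group_scope.

(** * Common prefixes of lists *)

Section CommonPrefix.
Variable T : eqType.
Implicit Types s t u : seq T.

Fixpoint lcp s t : nat :=
  match s, t with
  | x :: s', y :: t' => if x == y then (lcp s' t').+1 else 0%N
  | _, _ => 0%N
  end.

Lemma lcpC s t : lcp s t = lcp t s.
Proof.
by elim: s t => [|x s IHs] [|y t] //=; rewrite eq_sym; case: eqP => // _; rewrite IHs.
Qed.

Lemma lcp_cat s t : lcp s (s ++ t) = size s.
Proof. by elim: s => //= x s ->; rewrite eqxx. Qed.

Lemma lcp_ultra s t u : (minn (lcp s t) (lcp s u) <= lcp t u)%N.
Proof.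
elim: s t u => [|x s IHs] [|y t] [|z u] //=; rewrite ?min0n ?minn0 //.
case: (x =P y) => [<-|_]; last by rewrite min0n.
by case: (x =P z) => _; rewrite ?minn0 ?minnSS // ltnS.
Qed.

Definition diverge s t : bool :=
  match s, t with x :: _, y :: _ => x != y | _, _ => true end.

Lemma lcp_split s t : exists p s' t',
  [/\ s = p ++ s', t = p ++ t', size p = lcp s t & diverge s' t'].
Proof.
elim: s t => [|x s IHs] [|y t].
- by exists [::], [::], [::].
- by exists [::], [::], (y :: t).
- by exists [::], (x :: s), [::].
- rewrite /=; case: eqP => [<-|/eqP xy]; last by exists [::], (x :: s), (y :: t).
  have [p [s' [t' [-> -> <- st']]]] := IHs t.
  by exists (x :: p), s', t'.
Qed.

Lemma take_lcp s t n : (n <= lcp s t)%N -> take n s = take n t.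
Proof.
elim: s t n => [|x s IHs] [|y t] [|n] //=.
by case: eqP => // <- nst; rewrite (IHs _ _ nst).
Qed.

End CommonPrefix.

(** * Subgroups and integer powers *)

Section SubGroupMembership.
Variables (A : groupType) (P : {pred A}) (S : subGroupType P).

Lemma mem_subgroup a : a \in P -> exists c : S, a = val c.
Proof. by move=> aP; exists (Sub a aP); rewrite SubK. Qed.

Lemma val_mem (c : S) : val c \in P. Proof. exact: valP. Qed.

Lemma sub_oneg : 1 \in P.
Proof. by rewrite -(val1 S) val_mem. Qed.

Lemma sub_mulg : {in P &, forall a b, a * b \in P}.
Proof.
by move=> _ _ /mem_subgroup[c ->] /mem_subgroup[d ->]; rewrite -valM val_mem.
Qed.

Lemma sub_invg : {in P, forall a, a^-1 \in P}.
Proof. by move=> _ /mem_subgroup[c ->]; rewrite -gmulfV val_mem. Qed.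

End SubGroupMembership.

Section IntegerPowers.
Variable H : groupType.
Implicit Types (x y c w : H) (i j k l : int).

Lemma mul_quo_commute (a b u v : H) : commute b u -> commute b v ->
  a * b^-1 * (u * v^-1) = a * u * (v * b)^-1.
Proof.
move=> bu bv; rewrite -bv invgM -!mulgA; congr (a * _).
rewrite (_ : b^-1 * (u * v^-1) = u * b^-1 * v^-1); last first.
  by rewrite mulgA; congr (_ * _); apply/esym/commuteV; exact/esym.
rewrite -mulgA; congr (u * _).
by apply: commuteV; apply/esym/commuteV; exact/esym.
Qed.

Lemma expgzB x (m n : nat) : expgz x (m%:Z - n%:Z)%R = x ^+ m * x ^- n.
Proof.
have [nm|/ltnW mn] := leqP n m; first by rewrite subzn //= expgnFr.
rewrite -GRing.opprB subzn //.
have -> : x ^+ m * x ^- n = x ^- (n - m).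
  by rewrite expgnFr // invgM invgK.
by case: (n - m)%N => [|p] //=; rewrite invg1.
Qed.

Lemma intB k : exists m n : nat, k = (m%:Z - n%:Z)%R.
Proof. by case: k => n; [exists n, 0%N|exists 0%N, n.+1]; lia. Qed.

Lemma expgzD x i j : expgz x (i + j)%R = expgz x i * expgz x j.
Proof.
have [m [n ->]] := intB i; have [p [q ->]] := intB j.
have -> : (m%:Z - n%:Z + (p%:Z - q%:Z) = (m + p)%:Z - (q + n)%:Z)%R by lia.
rewrite !expgzB !expgnDr; apply/esym/mul_quo_commute; exact: commuteX2.
Qed.

Lemma expgzN x k : expgz x (- k)%R = (expgz x k)^-1.
Proof.
by apply: (mulgI (expgz x k)); rewrite -expgzD GRing.addrN mulgV.
Qed.

Lemma commuteXz x y k : commute x y -> commute x (expgz y k).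
Proof.
move=> xy; case: k => n /=; first exact: commuteX.
exact/commuteV/commuteX.
Qed.

Lemma commuteXz2 x y i j : commute x y -> commute (expgz x i) (expgz y j).
Proof. by move=> xy; apply/commuteXz/esym/commuteXz/esym. Qed.

Lemma expgz_conj g c k : expgz (g * c * g^-1) k = g * expgz c k * g^-1.
Proof.
have cX n : (g * c * g^-1) ^+ n = g * c ^+ n * g^-1.
  elim: n => [|n IHn]; first by rewrite !expg0 mulg1 mulgV.
  by rewrite !expgS IHn -!mulgA mulKg.
by case: k => n /=; rewrite cX // !invgM invgK mulgA.
Qed.

Lemma expgz_prodM c w i j k l : commute c w ->
  expgz c i * expgz w j * (expgz c k * expgz w l) =
  expgz c (i + k)%R * expgz w (j + l)%R.
Proof.
move=> cw; rewrite !expgzD -!mulgA; congr (_ * _).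
rewrite !mulgA; congr (_ * _); apply: commuteXz2; exact: esym.
Qed.

Lemma expgz_prodV c w i j : commute c w ->
  (expgz c i * expgz w j)^-1 = expgz c (- i)%R * expgz w (- j)%R.
Proof. by move=> cw; rewrite invgM -!expgzN; apply/commuteXz2/esym. Qed.

End IntegerPowers.

(** * Associated subgroups and coset representatives *)

Section NormalForm.

Variables (A : groupType) (Cm Cp : {pred A}).
Variables (Sm : subGroupType Cm) (Sp : subGroupType Cp).
Variables (phi : {multiplicative Sm -> Sp}) (psi : Sp -> Sm).
Hypotheses (phiK : cancel phi psi) (psiK : cancel psi phi).

Local Notation C := (assoc_pred Cm Cp).
Local Notation G := (hnn phi).
Local Notation inA := (hnn_in phi).
Local Notation texp := (hnn_texp phi).

Lemma assoc1 e : 1 \in C e.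
Proof. by case: e; [exact: (sub_oneg Sp)|exact: (sub_oneg Sm)]. Qed.

Lemma assocM e : {in C e &, forall a b, a * b \in C e}.
Proof. by case: e; [exact: (sub_mulg Sp)|exact: (sub_mulg Sm)]. Qed.

Lemma assocV e : {in C e, forall a, a^-1 \in C e}.
Proof. by case: e; [exact: (sub_invg Sp)|exact: (sub_invg Sm)]. Qed.

Lemma assocVE e a : (a^-1 \in C e) = (a \in C e).
Proof. by apply/idP/idP => /assocV; rewrite ?invgK. Qed.

Lemma assocMl e a b : a \in C e -> (a * b \in C e) = (b \in C e).
Proof.
move=> aC; apply/idP/idP => [abC|]; last exact: assocM.
by rewrite -(mulKg a b) assocM ?assocV.
Qed.

Lemma assocMr e a b : b \in C e -> (a * b \in C e) = (a \in C e).
Proof. by move=> bC; rewrite -assocVE invgM assocMl ?assocVE. Qed.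

Lemma assoc_quoC e a b : (a^-1 * b \in C e) = (b^-1 * a \in C e).
Proof. by rewrite -assocVE invgM invgK. Qed.

(** The map a |-> t^-e a t^e from C (~~ e) to C e, that is phi or its inverse;
it is total on A, with the junk value 1 outside C (~~ e). *)
Definition shift (e : bool) (a : A) : A :=
  if e then oapp (fun c : Sm => val (phi c)) 1 (insub a)
  else oapp (fun c : Sp => val (psi c)) 1 (insub a).

Lemma shift_phi (c : Sm) : shift true (val c) = val (phi c).
Proof. by rewrite /shift valK. Qed.

Lemma shift_psi (c : Sp) : shift false (val c) = val (psi c).
Proof. by rewrite /shift valK. Qed.

Lemma shift_in e a : a \in C (~~ e) -> shift e a \in C e.
Proof.
case: e => [/(mem_subgroup Sm)|/(mem_subgroup Sp)] [c ->].
  by rewrite shift_phi (val_mem (phi c)).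
by rewrite shift_psi (val_mem (psi c)).
Qed.

Lemma shiftM e : {in C (~~ e) &, {morph shift e : a b / a * b}}.
Proof.
have psiM := can2_gmulfM phiK psiK.
case: e => a b.
  move=> /(mem_subgroup Sm)[c ->] /(mem_subgroup Sm)[d ->].
  by rewrite -valM !shift_phi gmulfM valM.
move=> /(mem_subgroup Sp)[c ->] /(mem_subgroup Sp)[d ->].
by rewrite -valM !shift_psi psiM valM.
Qed.

Lemma shift1 e : shift e 1 = 1.
Proof. by apply: (mulgI (shift e 1)); rewrite -shiftM ?assoc1 // !mulg1. Qed.

Lemma shiftK e : {in C (~~ e), cancel (shift e) (shift (~~ e))}.
Proof.
case: e => [_ /(mem_subgroup Sm)[c ->]|_ /(mem_subgroup Sp)[c ->]].
  by rewrite shift_phi shift_psi phiK.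
by rewrite shift_psi shift_phi psiK.
Qed.

Lemma inA1 : inA 1 = 1.
Proof. by apply: (mulgI (inA 1)); rewrite -hnn_in_morph !mulg1. Qed.

Lemma inAV a : inA a^-1 = (inA a)^-1.
Proof. by apply: (mulgI (inA a)); rewrite -hnn_in_morph !mulgV inA1. Qed.

Lemma texpK e (g : G) : texp e * (texp (~~ e) * g) = g.
Proof. by case: e; rewrite /= ?mulKg ?mulVKg. Qed.

Lemma texpV e : (texp e)^-1 = texp (~~ e).
Proof. by case: e; rewrite /= ?invgK. Qed.

Lemma in_texp e a : a \in C (~~ e) -> inA a * texp e = texp e * inA (shift e a).
Proof.
case: e => [/(mem_subgroup Sm)|/(mem_subgroup Sp)] [c ->].
  by rewrite shift_phi -hnn_conj -!mulgA mulVKg.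
have := hnn_conj phi (psi c); rewrite psiK shift_psi => <-.
by rewrite -!mulgA mulgV mulg1.
Qed.

(** Representative of the left coset a C_e. The trivial coset is represented by
1, so that a t^e followed by t^-e cancels in a list of representatives
exactly when the representative between them is 1. *)
Definition rep (e : bool) (a : A) : A :=
  if a \in C e then 1 else choose [pred b | a^-1 * b \in C e] a.

Lemma rep_in e a : a^-1 * rep e a \in C e.
Proof.
rewrite /rep; case: ifP => [aC|_]; first by rewrite mulg1 assocV.
by apply: (chooseP (P := [pred b | a^-1 * b \in C e])); rewrite /= mulVg assoc1.
Qed.

Lemma rep_eq1 e a : (rep e a == 1) = (a \in C e).
Proof.
apply/eqP/idP => [r1|]; last by rewrite /rep => ->.
by have := rep_in e a; rewrite r1 mulg1 => /assocV; rewrite invgK.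
Qed.

Lemma eq_rep e a b : (rep e a == rep e b) = (a^-1 * b \in C e).
Proof.
apply/eqP/idP => [ab|ab].
  rewrite -(mulVKg (rep e a) b) mulgA {2}ab.
  by rewrite assocM ?rep_in // -assocVE invgM invgK rep_in.
have abC : (a \in C e) = (b \in C e).
  by rewrite -(mulVKg a b) assocMr.
rewrite /rep abC; case: ifP => // _.
have PQ : [pred c | a^-1 * c \in C e] =1 [pred c | b^-1 * c \in C e].
  by move=> c /=; rewrite -{1}(mulVKg b c) mulgA assocMl.
rewrite (eq_choose PQ); apply: choose_id; rewrite /= ?mulVg ?assoc1 //.
by rewrite assoc_quoC.
Qed.

Lemma rep_res e a : (rep e a)^-1 * a \in C e.
Proof. by rewrite assoc_quoC rep_in. Qed.

Lemma repM e b a : rep e (b * rep e a) = rep e (b * a).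
Proof. by apply/eqP; rewrite eq_rep invgM mulgA mulgVK rep_res. Qed.

Lemma repK e a : rep e (rep e a) = rep e a.
Proof. by have := repM e 1 a; rewrite !mul1g. Qed.

(** * Normal forms and the action on them *)

Local Notation nword := (seq (A * bool)).

(** Whether t^e cancels against the first stable letter of w; the pair (r, e')
stands for r t^e'. *)
Definition cancels (e : bool) (w : nword) : bool :=
  if w is (r, e') :: _ then (e' == ~~ e) && (r == 1) else false.

Fixpoint normal (w : nword) : bool :=
  if w is (r, e) :: w' then
    [&& rep (~~ e) r == r, ~~ cancels e w' & normal w'] else true.

(** Left multiplication of w by b in A: a factor b r t^e is rewritten as
r' t^e c with r' a representative, and c is passed to the rest of the list.
The second component is what comes out at the right end. *)
Fixpoint push (b : A) (w : nword) : nword * A :=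
  if w is (r, e) :: w' then
    let r' := rep (~~ e) (b * r) in
    let s := push (shift e (r'^-1 * (b * r))) w' in ((r', e) :: s.1, s.2)
  else ([::], b).

Definition actA (b : A) (s : nword * A) : nword * A :=
  ((push b s.1).1, (push b s.1).2 * s.2).

Definition actT (e : bool) (s : nword * A) : nword * A :=
  (if cancels e s.1 then behead s.1 else (1, e) :: s.1, s.2).

Lemma pushM b c w :
  push (b * c) w =
  ((push b (push c w).1).1, (push b (push c w).1).2 * (push c w).2).
Proof.
elim: w b c => [|[r e] w IHw] b c //=.
set q := (rep _ (c * r))^-1 * _.
have -> : rep (~~ e) (b * c * r) = rep (~~ e) (b * rep (~~ e) (c * r)).
  by rewrite repM mulgA.
set p := (rep _ (b * _))^-1 * (b * _); rewrite -[X in shift e X](_ : p * q = _).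
  rewrite shiftM ?rep_res // IHw //.
by rewrite /p /q -!mulgA mulVKg.
Qed.

Lemma push1 w : normal w -> push 1 w = (w, 1).
Proof.
elim: w => [|[r e] w IHw] //= /and3P[/eqP rr _ nw].
by rewrite mul1g rr mulVg shift1 IHw.
Qed.

Lemma cancels_push e c w : normal w -> c \in C e ->
  cancels e (push c w).1 = cancels e w.
Proof.
case: w => [|[r e'] w] //= /and3P[/eqP rr _ _] cC.
case: eqP => //= e'E; rewrite e'E negbK in rr *.
by rewrite rep_eq1 assocMl // -[in RHS]rr rep_eq1.
Qed.

Lemma normal_push b w : normal w -> normal (push b w).1.
Proof.
elim: w b => [|[r e] w IHw] b //= /and3P[rr cw nw].
by rewrite repK eqxx IHw // cancels_push ?cw // shift_in // rep_res.
Qed.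

Lemma normal_actT e s : normal s.1 -> normal (actT e s).1.
Proof.
case: s => -[|[r e'] w] a /=; rewrite /actT /=.
  by rewrite rep_eq1 assoc1.
move=> /and3P[rr cw nw]; case: ifP => [//|/negbT cr] /=.
by rewrite rr cw nw cr rep_eq1 assoc1.
Qed.

Lemma actTK e s : normal s.1 -> actT e (actT (~~ e) s) = s.
Proof.
case: s => w a; rewrite /actT /= => nw; congr pair.
case: (boolP (cancels (~~ e) w)) => [|_]; last by rewrite /= !eqxx.
case: w nw => [|[r e'] w] //= /and3P[_ cw _] /andP[/eqP e'E /eqP ->].
by rewrite negbK in e'E; rewrite -e'E (negbTE cw).
Qed.

Lemma actA_actT e c s : c \in C (~~ e) -> normal s.1 ->
  actA c (actT e s) = actT e (actA (shift e c) s).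
Proof.
case: s => w a /= cC nw; rewrite /actT /actA /= cancels_push ?shift_in //.
case: ifP => [|_] /=.
  case: w nw => [|[r e'] w] //= _ /andP[/eqP -> /eqP ->].
  have /eqP -> : rep (~~ ~~ e) (shift e c * 1) == 1.
    by rewrite rep_eq1 mulg1 negbK shift_in.
  by rewrite invg1 mul1g mulg1 shiftK.
have /eqP -> : rep (~~ e) (c * 1) == 1 by rewrite rep_eq1 mulg1.
by rewrite invg1 mul1g mulg1.
Qed.

Definition act1 (l : A + bool) (s : nword * A) : nword * A :=
  match l with inl b => actA b s | inr e => actT e s end.

Lemma normal_act u s : normal s.1 -> normal (foldr act1 s u).1.
Proof.
move=> ns; elim: u => [|[b|e] u IHu] //=; first exact: normal_push.
exact: normal_actT.
Qed.

(** Each defining relation of the HNN extension acts trivially on normal forms,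
so the action of words descends to the group. *)
Lemma act_hnn_eq u v : hnn_eq phi u v ->
  forall s, normal s.1 -> foldr act1 s u = foldr act1 s v.
Proof.
elim=> {u v} [u|u v _ IH|u v w _ IH1 _ IH2|u u' v v' _ IH1 _ IH2||a b|e|c] s ns //.
- by rewrite IH.
- by rewrite IH1 // IH2.
- by rewrite !foldr_cat IH2 // IH1 // normal_act.
- by case: s ns => w a /= nw; rewrite /actA /= push1 // mul1g.
- by rewrite /= /actA /= pushM mulgA.
- by rewrite /= actTK.
- have cC : val c \in C (~~ true) by exact: val_mem.
  by rewrite /= actA_actT // (actTK false) ?shift_phi // normal_push.
Qed.

(** The image of the trivial normal form under g. *)
Definition nform (g : G) : nword * A := foldr act1 ([::], 1) (repr g).

Lemma nform_pi u : nform (\pi_G%qT u) = foldr act1 ([::], 1) u.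
Proof. by apply: act_hnn_eq => //; exact: hnn_reprP. Qed.

Lemma normal_nform g : normal (nform g).1.
Proof. exact: normal_act. Qed.

Lemma nform1 : nform 1 = ([::], 1).
Proof. exact: (nform_pi [::]). Qed.

Lemma nform_in b g : nform (inA b * g) = actA b (nform g).
Proof.
rewrite -[LHS]/(nform (hnn_mul _ _)) -{1}[g]reprK hnn_mul_pi nform_pi /=.
by congr actA.
Qed.

Lemma nform_texp e g : nform (texp e * g) = actT e (nform g).
Proof.
rewrite -[LHS]/(nform (hnn_mul _ _)) -{1}[g]reprK hnn_texpE hnn_mul_pi nform_pi /=.
by congr actT.
Qed.

Lemma hnn_ind (P : G -> Prop) : P 1 ->
  (forall b g, P g -> P (inA b * g)) -> (forall e g, P g -> P (texp e * g)) ->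
  forall g, P g.
Proof.
move=> P1 PA Pt; elim/quotW; elim=> [//|l u IHu].
rewrite -cat1s -hnn_mul_pi; case: l => [b|e]; first exact: PA.
by rewrite -hnn_texpE; exact: Pt.
Qed.

Fixpoint wprod (w : nword) : G :=
  if w is (r, e) :: w' then inA r * (texp e * wprod w') else 1.

Lemma push_wprod b w : inA b * wprod w = wprod (push b w).1 * inA (push b w).2.
Proof.
elim: w b => [|[r e] w IHw] b /=; first by rewrite mulg1 mul1g.
set c := _^-1 * _.
have -> : inA b * (inA r * (texp e * wprod w)) =
          inA (rep (~~ e) (b * r)) * (inA c * texp e * wprod w).
  by rewrite !mulgA -!hnn_in_morph mulVKg.
by rewrite in_texp ?rep_res // -!mulgA IHw.
Qed.

Lemma wprod_nform g : g = wprod (nform g).1 * inA (nform g).2.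
Proof.
elim/hnn_ind: g => [|b g|e g].
- by rewrite nform1 /= inA1 mulg1.
- rewrite nform_in /= => {1}->; rewrite hnn_in_morph !mulgA; congr (_ * _).
  by rewrite push_wprod.
- rewrite nform_texp /actT => {1}->; rewrite mulgA; congr (_ * _) => /=.
  case: ifP => [|_]; last by rewrite /= inA1 mul1g.
  case: (nform g).1 => [|[r e'] w] //= /andP[/eqP -> /eqP ->].
  by rewrite inA1 mul1g texpK.
Qed.

(** With [wprod_nform], this makes g |-> [nform g] a bijection onto normal
forms. *)
Lemma nform_wprod w a : normal w -> nform (wprod w * inA a) = (w, a).
Proof.
elim: w => [_|[r e] w IHw] /=.
  by rewrite mul1g -[inA a]mulg1 nform_in nform1 /actA /= mulg1.
move=> /and3P[/eqP rr cw nw]; rewrite -!mulgA nform_in nform_texp IHw //.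
rewrite /actT /= (negbTE cw) /actA /= mulg1 rr mulVg shift1 push1 //=.
by rewrite mul1g.
Qed.

(** * Geodesics and distances in the Bass-Serre tree *)

(** The coset g A, as the geodesic that joins A to it. *)
Definition geod (g : G) : nword := (nform g).1.
Definition tlen (g : G) : nat := size (geod g).
Local Arguments geod g%_g.
Local Arguments tlen g%_g.

Lemma normal_geod g : normal (geod g).
Proof. exact: normal_nform. Qed.

Lemma geod_wprod w : normal w -> geod (wprod w) = w.
Proof. by move=> nw; rewrite -[wprod w]mulg1 -inA1 /geod nform_wprod. Qed.

Lemma geod_inl b g : geod (inA b * g) = (push b (geod g)).1.
Proof. by rewrite /geod nform_in. Qed.

Lemma geod_inr g b : geod (g * inA b) = geod g.
Proof. by rewrite {1}(wprod_nform g) -mulgA -hnn_in_morph /geod nform_wprod ?normal_nform. Qed.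

Lemma geod_texp e g :
  geod (texp e * g) = if cancels e (geod g) then behead (geod g) else (1, e) :: geod g.
Proof. by rewrite /geod nform_texp. Qed.

Lemma wprod_geod g : exists a, g = wprod (geod g) * inA a.
Proof. by exists (nform g).2; exact: wprod_nform. Qed.

Lemma geod_inj g h : geod g = geod h -> exists a, h = g * inA a.
Proof.
have [a ->] := wprod_geod g; have [b ->] := wprod_geod h.
rewrite !geod_inr !geod_wprod ?normal_geod //.
by move->; exists (a^-1 * b); rewrite hnn_in_morph inAV -mulgA mulVKg.
Qed.

Lemma size_push b w : size (push b w).1 = size w.
Proof. by elim: w b => [|[r e] w IHw] b //=; rewrite IHw. Qed.

Lemma tlen_inl b g : tlen (inA b * g) = tlen g.
Proof. by rewrite /tlen geod_inl size_push. Qed.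

Lemma tlen_inr g b : tlen (g * inA b) = tlen g.
Proof. by rewrite /tlen geod_inr. Qed.

Lemma tlen_wprod w : normal w -> tlen (wprod w) = size w.
Proof. by move=> nw; rewrite /tlen geod_wprod. Qed.

Lemma wprod_cat u v : wprod (u ++ v) = wprod u * wprod v.
Proof. by elim: u => [|[r e] u IHu] /=; rewrite ?mul1g // IHu !mulgA. Qed.

Lemma normal_catl u v : normal (u ++ v) -> normal u.
Proof.
elim: u => [|[r e] u IHu] //= /and3P[-> cuv /IHu ->].
by rewrite andbT; case: (u) cuv => [|[]].
Qed.

Lemma normal_catr u v : normal (u ++ v) -> normal v.
Proof. by elim: u => [|[r e] u IHu] //= /and3P[_ _ /IHu]. Qed.

(** The inverse of u followed by g admits no cancellation, since the first
letters of u and of g lie in different cosets or have different signs. *)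
Lemma tlen_diverge u (g : G) : normal u -> diverge u (geod g) ->
  tlen ((wprod u)^-1 * g) = (size u + tlen g)%N.
Proof.
elim: u g => [|[r e] u IHu] g; first by rewrite invg1 mul1g.
move=> /= /and3P[/eqP rr cu nu] dg.
rewrite !invgM texpV -inAV -!mulgA.
have Vg' : geod (texp (~~ e) * (inA r^-1 * g)) = (1, ~~ e) :: (push r^-1 (geod g)).1.
  rewrite geod_texp geod_inl; case: ifP => // /idPn []; have := normal_geod g.
  case: (geod g) dg => [|[r1 e1] w] //= dg /and3P[/eqP rr1 _ _].
  rewrite negbK; case: eqP => //= e1E; subst e1.
  rewrite rep_eq1 -eq_rep rr rr1; apply: contra dg => /eqP ->.
  by rewrite eqxx.
rewrite IHu //.
  by rewrite /tlen Vg' /= size_push addnS.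
rewrite Vg' /=; case: (u) cu => [|[r2 e2] w] //=.
by rewrite xpair_eqE andbC.
Qed.

(** After removal of the common prefix, the two geodesics leave their last common
vertex along different edges and [tlen_diverge] applies. *)
Lemma tlen_quo (g h : G) : (tlen (g^-1 * h) + (lcp (geod g) (geod h)).*2 = tlen g + tlen h)%N.
Proof.
have [a gE] := wprod_geod g; have [b hE] := wprod_geod h.
have [p [u [v [Vg Vh <- duv]]]] := lcp_split (geod g) (geod h).
have ng := normal_geod g; have nh := normal_geod h.
rewrite [X in tlen (X^-1 * _)]gE [X in tlen (_ * X)]hE Vg Vh !wprod_cat.
rewrite Vg in ng; rewrite Vh in nh.
rewrite !invgM -!mulgA mulKg -inAV tlen_inl mulgA tlen_inr tlen_diverge.
- by rewrite tlen_wprod ?(normal_catr nh) // /tlen Vg Vh !size_cat addnACA addnn addnC.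
- exact: normal_catr ng.
- by rewrite geod_wprod ?(normal_catr nh).
Qed.

Lemma tlen_inv (g : G) : tlen g^-1 = tlen g.
Proof.
have V1 : geod 1 = [::] by rewrite /geod nform1.
by have := tlen_quo g 1; rewrite mulg1 /tlen V1 lcpC /= !addn0.
Qed.

(** The four points A, x A, y A, x y A form a quadrilateral with opposite sides
of equal length |x|, |y|, because x y = y x; in a tree the sum of the lengths
of the diagonals is at most the larger of 2 |x| and 2 |y|. *)
Lemma commute_four_point (x y : G) : commute x y -> (tlen x <= tlen y)%N ->
  (tlen (x^-1 * y) + tlen (x * y) <= (tlen y).*2)%N.
Proof.
move=> xy Lxy; have D1 := tlen_quo x y.
have := tlen_quo x (x * y); rewrite mulKg => D2.
have := tlen_quo y (x * y); rewrite {1}xy mulKg => D3.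
have := lcp_ultra (geod (x * y)) (geod x) (geod y).
rewrite ![lcp (geod (x * y)) _]lcpC.
lia.
Qed.

(** The hypotheses place the midpoints of the geodesics from A to x A and from A
to x^-1 A at distance |x| / 2 from A on the geodesic to y A, so they
coincide. As x maps the second geodesic to the first one reversed, it fixes
their common midpoint. *)
Lemma elliptic_of_tlen (x y : G) : tlen (x^-1 * y) = tlen y -> tlen (x * y) = tlen y ->
  exists g, in_conj_base g x.
Proof.
move=> D1 D2; have E1 := tlen_quo x y; have E2 := tlen_quo x^-1 y.
rewrite D1 in E1; rewrite invgK tlen_inv D2 in E2.
pose m := lcp (geod x) (geod y); pose p := take m (geod x); pose P := wprod p.
have LxE : tlen x = m.*2 by rewrite /m; lia.
have mV : lcp (geod x^-1) (geod y) = m by rewrite /m; lia.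
have pV : p = take m (geod x^-1).
  by rewrite /p (take_lcp (leqnn m)) (take_lcp (t := geod y)) // mV.
have np : normal p by apply: (@normal_catl _ (drop m (geod x))); rewrite cat_take_drop normal_geod.
have VP : geod P = p by rewrite geod_wprod.
have sp : size p = m by rewrite size_take -/(tlen x) LxE; case: ltnP; lia.
have LP : tlen P = m by rewrite /tlen VP.
(* P A is the midpoint; x P A is at distance m from both A and x A. *)
have LxP : tlen (x * P) = m.
  have := tlen_quo P x^-1; rewrite VP -invgM !tlen_inv.
  suff -> : lcp p (geod x^-1) = m by rewrite LP LxE => /addIn.
  by rewrite -(cat_take_drop m (geod x^-1)) -pV lcp_cat.
have := tlen_quo (x * P) x; rewrite invgM mulgVK tlen_inv LP LxP LxE => E3.
have VxP : geod (x * P) = geod P.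
  rewrite VP -[LHS](take_size) -/(tlen _) LxP.
  by apply: take_lcp; lia.
have [a xPE] := geod_inj VxP.
exists P, a^-1.
by rewrite inAV; apply: (mulIg P); apply: (mulIg (inA a)); rewrite !mulgVK -xPE.
Qed.

(** * Centralizers of elliptic elements *)

(** An element a of A commuting with z fixes both A and z A. If these vertices
differ, a fixes the first edge of the geodesic between them, and the
stabilizer of an edge is conjugate to an associated subgroup. *)
Lemma centralizer_base (g x y : G) : commute x y ->
  in_conj_base g x -> ~ conj_to_assocU x -> in_conj_base g y.
Proof.
move=> xy [a xE] nx; pose z := g^-1 * y * g.
have az : inA a * z = z * inA a.
  rewrite (_ : inA a = g^-1 * x * g); last by rewrite xE !mulgA mulVg mul1g mulgVK.
  by rewrite /z -!mulgA !mulVKg; rewrite (mulgA x y) xy !mulgA.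
have := geod_inr z a; rewrite -az geod_inl.
have nz := normal_geod z; have [b zE] := wprod_geod z.
case: (geod z) nz zE => [|[r e] w] /=.
  rewrite mul1g => _ zE _; exists b; rewrite -zE /z !mulgA mulgV mul1g mulgK //.
move=> /and3P[/eqP rr _ _] _ [rE _]; case: nx.
exists (g * inA r), (inA (r^-1 * a * r)); split; last first.
  rewrite xE !hnn_in_morph inAV invgM !mulgA; congr (_ * _).
  by rewrite mulgK -(mulgA g) mulgV mulg1.
have rC : r^-1 * a * r \in C (~~ e) by rewrite -mulgA -eq_rep rE rr.
by case: e rC {rr rE}; [right|left]; exists (r^-1 * a * r).
Qed.

(** * Euclid's algorithm for commuting pairs *)

Definition elliptic_root_pair (x y : G) : Prop :=
  exists (c W : G) (i j k l : int),
    [/\ commute c W, exists g, in_conj_base g c,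
        x = expgz c i * expgz W j & y = expgz c k * expgz W l].

Lemma elliptic_root_pairC (x y : G) :
  elliptic_root_pair x y -> elliptic_root_pair y x.
Proof.
by move=> [c [W [i [j [k [l [cW ce xE yE]]]]]]]; exists c, W, k, l, i, j.
Qed.

Lemma elliptic_root_pairM (x y : G) :
  elliptic_root_pair x (x * y) -> elliptic_root_pair x y.
Proof.
move=> [c [W [i [j [k [l [cW ce xE xyE]]]]]]].
exists c, W, i, j, (- i + k)%R, (- j + l)%R; split=> //.
by rewrite -[y](mulKg x) xyE xE expgz_prodV // expgz_prodM.
Qed.

Lemma elliptic_root_pairV (x y : G) :
  elliptic_root_pair x (x^-1 * y) -> elliptic_root_pair x y.
Proof.
move=> [c [W [i [j [k [l [cW ce xE xyE]]]]]]].
exists c, W, i, j, (i + k)%R, (j + l)%R; split=> //.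
by rewrite -[y](mulVKg x) xyE xE expgz_prodM.
Qed.

(** Induction on |x| + |y|: see [commute_four_point] for the decrease and
[elliptic_of_tlen] for the terminal case. *)
Lemma commute_elliptic_root_pair (x y : G) : commute x y -> elliptic_root_pair x y.
Proof.
have [n] := ubnP (tlen x + tlen y); elim: n x y => // n IHn x y.
wlog Lxy : x y / (tlen x <= tlen y)%N => [IH|Ln xy].
  have [Lxy|/ltnW Lyx] := leqP (tlen x) (tlen y); first exact: IH.
  by rewrite addnC => Ln xy; apply/elliptic_root_pairC/IH.
rewrite ltnS in Ln; have L4 := commute_four_point xy Lxy.
have [ltM|geM] := ltnP (tlen (x * y)) (tlen y).
  apply: elliptic_root_pairM; apply: IHn; last by apply: commuteM.
  by apply: leq_trans Ln; rewrite ltn_add2l.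
have [ltV|geV] := ltnP (tlen (x^-1 * y)) (tlen y).
  apply: elliptic_root_pairV; apply: IHn.
    by apply: leq_trans Ln; rewrite ltn_add2l.
  by apply: commuteM => //; exact: commuteV.
have ex : exists g, in_conj_base g x by apply: (@elliptic_of_tlen x y); lia.
exists x, y, 1%R, 0%R, 0%R, 1%R; split=> //.
- by rewrite /= mulg1.
- by rewrite /= mul1g.
Qed.

Lemma inXz a k : inA (expgz a k) = expgz (inA a) k.
Proof.
have inX n : inA (a ^+ n) = inA a ^+ n.
  by elim: n => [|n IHn]; rewrite ?inA1 // !expgS hnn_in_morph IHn.
by case: k => n; rewrite /expgz -?inX // inAV.
Qed.

Lemma in_assocXz e (c : G) k : in_assoc e c -> in_assoc e (expgz c k).
Proof.
have memX a n : a \in C e -> a ^+ n \in C e.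
  move=> aC; elim: n => [|n IHn]; first exact: assoc1.
  by rewrite expgS assocM.
move=> [a aC ->]; exists (expgz a k); last by rewrite inXz.
by case: k => n; rewrite /expgz ?assocVE memX.
Qed.

Lemma in_conj_base_mulXz (g c W : G) i j :
  in_conj_base g c -> in_conj_base g W ->
  in_conj_base g (expgz c i * expgz W j).
Proof.
move=> [a ->] [b ->]; exists (expgz a i * expgz b j).
by rewrite !expgz_conj hnn_in_morph !inXz !mulgA mulgVK.
Qed.

(** The elliptic generator c must be conjugate into an associated subgroup, as
otherwise its centralizer, which contains x, would fix a vertex; powers of c
are then conjugate into the same associated subgroup by the same element. *)
Lemma hyperbolic_common_root (x y : G) : commute x y ->
  ~ (exists g, in_conj_base g x) -> common_root_form x y.
Proof.
move=> xy nx; have [c [W [i [j [k [l [cW [g cg] xE yE]]]]]]] := commute_elliptic_root_pair xy.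
have [[h [c0 [c0C cE]]]|nc] := pselect (conj_to_assocU c); last first.
  case: nx; exists g; rewrite xE; apply: in_conj_base_mulXz => //.
  exact: centralizer_base cW cg nc.
have [e c0e] : exists e, in_assoc e c0.
  by case: c0C => ?; [exists true|exists false].
exists h, W, j, l, e, (expgz c0 i), (expgz c0 k).
rewrite -!expgz_conj -cE; split=> //.
- by split; exact: in_assocXz.
- by split; [exact: commuteXz2|exact/esym/commuteXz/esym|exact/esym/commuteXz/esym].
Qed.

(** * Chains of conjugations along a reduced form *)

Lemma hnn_exprS n (ys : nat -> A) (eps : nat -> bool) :
  hnn_expr phi n.+1 ys eps =
  inA (ys 1%N) *
    (texp (eps 1%N) * hnn_expr phi n (fun i => ys i.+1) (fun i => eps i.+1)).
Proof. by rewrite /hnn_expr big_nat_recl // !mulgA. Qed.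

Lemma hnn_reducedS n (ys : nat -> A) (eps : nat -> bool) :
  hnn_reduced Cm Cp n.+1 ys eps ->
  hnn_reduced Cm Cp n (fun i => ys i.+1) (fun i => eps i.+1).
Proof. by move=> red i ilt; apply: red; lia. Qed.

(** The first letter of a reduced form is not affected by the normalization of
what follows it: only its coset representative is adjusted. *)
Lemma geod_expr n (ys : nat -> A) (eps : nat -> bool) :
  hnn_reduced Cm Cp n.+1 ys eps ->
  exists w, geod (hnn_expr phi n.+1 ys eps) =
            (rep (~~ eps 1%N) (ys 1%N), eps 1%N) :: w.
Proof.
elim: n ys eps => [|n IHn] ys eps red; rewrite hnn_exprS geod_inl geod_texp.
  rewrite /hnn_expr big_geq // mul1g -[inA _]mulg1 geod_inl /geod nform1 /= mulg1.
  by eexists.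
have [w ->] := IHn _ _ (hnn_reducedS red).
rewrite /= rep_eq1 ifN /= ?mulg1; first by eexists.
apply/negP => /andP[/eqP e21]; rewrite e21 negbK; apply/negP.
exact: (red 1%N).
Qed.

(** Both sides have the same first vertex after A, namely the one that starts
the reduced form; on the left-hand side it has been moved by c. *)
Lemma hnn_reduced_commute n (ys : nat -> A) (eps : nat -> bool) c d :
  hnn_reduced Cm Cp n.+1 ys eps ->
  inA c * hnn_expr phi n.+1 ys eps = hnn_expr phi n.+1 ys eps * inA d ->
  (ys 1%N)^-1 * (c * ys 1%N) \in C (~~ eps 1%N).
Proof.
move=> red /(congr1 geod); rewrite geod_inl geod_inr.
have [w ->] := geod_expr red; rewrite /= repM => -[/eqP + _].
by rewrite eq_rep assoc_quoC.
Qed.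

(** The right factor d is kept distinct from c because the induction moves c
through the letters of the reduced form and leaves d unchanged. *)
Lemma conj_chain n (ys : nat -> A) (eps : nat -> bool) c d :
  hnn_reduced Cm Cp n ys eps ->
  inA c * hnn_expr phi n ys eps = hnn_expr phi n ys eps * inA d ->
  exists cs : nat -> A,
    [/\ cs 0%N = c, inA (cs n.*2.+1) = inA d,
        forall i, (0 < i <= n.*2)%N -> exists e, cs i \in C e
      & forall i, (i <= n.*2)%N ->
          if odd i
          then inA (cs i) = texp (eps i./2.+1) * inA (cs i.+1) * (texp (eps i./2.+1))^-1
          else inA (cs i) = inA (ys i./2.+1) * inA (cs i.+1) * (inA (ys i./2.+1))^-1].
Proof.
elim: n ys eps c => [|n IHn] ys eps c red.
  rewrite /hnn_expr big_geq // mul1g => cd.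
  exists (fun i => if i is 0 then c else (ys 1%N)^-1 * (c * ys 1%N)); split=> //.
  - by rewrite !hnn_in_morph cd inAV mulKg.
  - by case.
  - by case=> //= _; rewrite !hnn_in_morph inAV mulVKg mulgK.
move=> cd; have c1C := hnn_reduced_commute red cd.
set e := eps 1%N in c1C *; set c1 := _^-1 * _ in c1C; set y := ys 1%N in c1 c1C *.
have cE : inA c = inA y * inA c1 * (inA y)^-1.
  by rewrite /c1 !hnn_in_morph inAV mulVKg mulgK.
have c1E : inA c1 = texp e * inA (shift e c1) * (texp e)^-1.
  by rewrite -in_texp // mulgK.
have [|cs [cs0 csd csC csE]] := IHn _ _ (shift e c1) (hnn_reducedS red).
  move: cd; rewrite hnn_exprS -/e -/y -!mulgA => cd.
  apply: (mulgI (inA y * texp e)); rewrite -!mulgA -cd cE c1E.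
  by rewrite !mulgA mulgVK mulgVK.
exists (fun i => match i with 0 => c | 1 => c1 | i.+2 => cs i end); split=> //.
- case=> [|[|[|i]]] //= ilt.
  + by exists (~~ e).
  + by exists e; rewrite cs0 shift_in.
  + exact: csC.
- case=> [|[|i]] //= ilt; first by rewrite cs0.
  by rewrite negbK; exact: csE.
Qed.

End NormalForm.

Theorem mainTheorem5
    (A : groupType) (Cm Cp : {pred A})
    (Sm : subGroupType Cm) (Sp : subGroupType Cp)
    (phi : {multiplicative Sm -> Sp}) (phi_bij : bijective phi)
    (x y : hnn phi) (xy_comm : commute x y) :
  [/\ in_assocU x ->
      forall (n : nat) (ys : nat -> A) (eps : nat -> bool),
        reduced_form y n ys eps ->
        exists c : nat -> hnn phi,
          [/\ forall i, (i <= n.*2.+1)%N -> in_assocU (c i),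
              c 0 = x, c n.*2.+1 = x
            & forall i, (i <= n.*2)%N ->
                if odd i
                then c i = hnn_texp phi (eps i./2.+1) * c i.+1
                             * (hnn_texp phi (eps i./2.+1))^-1
                else c i = hnn_in phi (ys i./2.+1) * c i.+1
                             * (hnn_in phi (ys i./2.+1))^-1],
      forall g : hnn phi,
        in_conj_base g x -> ~ conj_to_assocU x -> in_conj_base g y,
      ~ (exists g, in_conj_base g x) -> ~ (exists g, in_conj_base g y) ->
      common_root_form x y
    & [\/ conj_to_assocU x \/ conj_to_assocU y,
          exists g : hnn phi,
            [/\ in_conj_base g x, ~ conj_to_assocU x & in_conj_base g y]
        | [/\ ~ (exists g, in_conj_base g x), ~ (exists g, in_conj_base g y)
            & common_root_form x y]]].
Proof.
have [psi phiK psiK] := phi_bij.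
have base (u v : hnn phi) g : commute u v ->
    in_conj_base g u -> ~ conj_to_assocU u -> in_conj_base g v.
  by move=> uv; exact: (centralizer_base phiK psiK uv).
have root := hyperbolic_common_root phiK psiK xy_comm.
split=> [xC n ys eps [red yE]|g|nx _|].
- have [a xE] : exists a, x = hnn_in phi a by case: xC => -[a _ ->]; exists a.
  have ay : hnn_in phi a * hnn_expr phi n ys eps =
            hnn_expr phi n ys eps * hnn_in phi a by rewrite -xE -yE.
  have [cs [cs0 csn csC csE]] := conj_chain phiK psiK red ay.
  exists (fun i => hnn_in phi (cs i)); split=> //; rewrite ?xE ?cs0 ?csn //.
  move=> i; rewrite leq_eqVlt => /predU1P[->|]; first by rewrite csn -xE.
  case: i => [_|i ilt]; first by rewrite cs0 -xE.
  have [e eC] := csC i.+1 ilt.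
  by case: e eC => eC; [left|right]; exists (cs i.+1).
- exact: base.
- exact: root.
- have [xC|nxC] := pselect (conj_to_assocU x); first by constructor 1; left.
  have [yC|nyC] := pselect (conj_to_assocU y); first by constructor 1; right.
  have [[g gx]|nx] := pselect (exists g, in_conj_base g x).
    by constructor 2; exists g; split=> //; exact: base gx nxC.
  constructor 3; split=> //; last exact: root.
  by move=> [g gy]; case: nx; exists g; exact: base (esym xy_comm) gy nyC.
Qed.
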